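(* Let $\mathbf{D}$ be the finitary distribution monad and $\mathbf{M}$ the maybe monad on the category of sets. The black-hole transformation $(-)^{\bot}\colon\mathbf{D}\mathbf{M}X\to\mathbf{M}\mathbf{D}X$ is the only distributive law of $\mathbf{D}$ over $\mathbf{M}$, i.e. it is a distributive law $\mathbf{D}\mathbf{M}\to\mathbf{M}\mathbf{D}$, and any distributive law $\psi\colon\mathbf{D}\mathbf{M}\to\mathbf{M}\mathbf{D}$ equals it.
   Context: Distribution monad: $\mathbf{D}X$ is the set of finite formal sums $\sum_i\lambda_i|x_i\rangle$ with $x_i\in X$, $\lambda_i>0$, $\sum_i\lambda_i=1$; unit $\eta^{\mathbf D}(x)=|x\rangle$; multiplication $\mu^{\mathbf D}(\sum_i\lambda_i|\sum_j\mu_{ij}|x_{ij}\rangle\rangle)=\sum_{i,j}\lambda_i\mu_{ij}|x_{ij}\rangle$. Maybe monad: $\mathbf{M}X=X+\{\bot\}$, with unit the inclusion and multiplication $\mathbf{M}\mathbf{M}X=X+\{\bot_1\}+\{\bot_2\}\to \mathbf{M}X$ sending both extra points to $\bot$. An element of $\mathbf{D}\mathbf{M}X$ is identified with a subdistribution, i.e. a finite formal sum $\sum_i\lambda_i|x_i\rangle$ over $X$ with $\lambda_i>0$ and $\sum_i\lambda_i\le 1$ (the missing mass is the coefficient of $\bot$). The zero formal sum $0$ stands for $|\bot\rangle\in\mathbf{D}\mathbf{M}X$ and also for $\bot\in\mathbf{M}\mathbf{D}X$. Black-hole semantics: $(\sum_i\lambda_i|x_i\rangle)^\bot=\sum_i\lambda_i|x_i\rangle$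 if $\sum_i\lambda_i=1$, and $(\sum_i\lambda_i|x_i\rangle)^\bot=0$ otherwise. Distributive law: given monads $(T,\mu^T,\eta^T)$ and $(S,\mu^S,\eta^S)$ on a category, a distributive law of $T$ over $S$ is a natural transformation $\psi_X\colon TSX\to STX$ with (1) $\psi_X\circ\mu^T_{SX}=S(\mu^T_X)\circ\psi_{TX}\circ T(\psi_X)$; (2) $\psi_X\circ\eta^T_{SX}=S(\eta^T_X)$; (3) $\psi_X\circ T(\mu^S_X)=\mu^S_{TX}\circ S(\psi_X)\circ\psi_{SX}$; (4) $\psi_X\circ T(\eta^S_X)=\eta^S_{TX}$. *)

(* Defs.v *)
From HB Require Import structures.
From mathcomp Require Import all_boot all_order all_algebra finmap.
From mathcomp Require Import boolp reals.

Set Implicit Arguments.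
Unset Strict Implicit.
Unset Printing Implicit Defensive.

Import Order.TTheory GRing.Theory Num.Theory.
Local Open Scope ring_scope.
Local Open Scope fset_scope.
Local Obligation Tactic := idtac.

(* The category of sets is [Type] with all functions; equality of functions is
   stated pointwise, which is the same as Leibniz equality by functional
   extensionality. *)
Record monad := Monad {
  mobj :> Type -> Type;
  mmap : forall X Y, (X -> Y) -> mobj X -> mobj Y;
  munit : forall X, X -> mobj X;
  mmult : forall X, mobj (mobj X) -> mobj X;
  mmap_id : forall X, mmap (@id X) =1 id;
  mmap_comp : forall X Y Z (g : Y -> Z) (f : X -> Y),
    mmap (g \o f) =1 mmap g \o mmap f;
  munit_nat : forall X Y (f : X -> Y), mmap f \o @munit X =1 @munit Y \o f;
  mmult_nat : forall X Y (f : X -> Y),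
    mmap f \o @mmult X =1 @mmult Y \o mmap (mmap f);
  mmultA : forall X, @mmult X \o mmap (@mmult X) =1 @mmult X \o @mmult (mobj X);
  mmult_unitl : forall X, @mmult X \o @munit (mobj X) =1 id;
  mmult_unitr : forall X, @mmult X \o mmap (@munit X) =1 id
}.

Arguments mmap m {X Y} f _.
Arguments munit m X _ : clear implicits.
Arguments mmult m X _ : clear implicits.

Record is_distributive_law (T S : monad) (psi : forall X, T (S X) -> S (T X)) :
    Prop := IsDistributiveLaw {
  distl_nat : forall X Y (f : X -> Y),
    psi Y \o mmap T (mmap S f) =1 mmap S (mmap T f) \o psi X;
  distl_multT : forall X,
    psi X \o mmult T (S X)
      =1 mmap S (mmult T X) \o psi (T X) \o mmap T (psi X);
  distl_unitT : forall X, psi X \o munit T (S X) =1 mmap S (munit T X);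
  distl_multS : forall X,
    psi X \o mmap T (mmult S X)
      =1 mmult S (T X) \o mmap S (psi X) \o psi (S X);
  distl_unitS : forall X, psi X \o mmap T (munit S X) =1 munit S (T X)
}.

Section Maybe.
Variables X Y : Type.

(* [None] is the extra point. *)
Definition maybe_map (f : X -> Y) (m : option X) : option Y :=
  if m is Some x then Some (f x) else None.

Definition maybe_mult (m : option (option X)) : option X :=
  if m is Some m' then m' else None.

End Maybe.

Program Definition maybe_monad : monad :=
  @Monad option (@maybe_map) (@Some) (@maybe_mult) _ _ _ _ _ _ _.
Next Obligation. by move=> X []. Qed.
Next Obligation. by move=> X Y Z g f []. Qed.
Next Obligation. by []. Qed.
Next Obligation. by move=> X Y f []. Qed.
Next Obligation. by move=> X []. Qed.
Next Obligation. by []. Qed.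
Next Obligation. by move=> X []. Qed.

Section Distribution.
Variable R : realType.

(* Finite formal sums over [X] with coefficients in [R]; [{classic X}] is [X]
   itself, with the choice structure provided by the axiom of choice. *)
Local Notation fsum X := {fsfun {classic X} -> R with 0}.

Definition is_dist (X : Type) (p : fsum X) : bool :=
  all (fun x => 0 < p x) (finsupp p) && (\sum_(x <- finsupp p) p x == 1).

Record dist (X : Type) := Dist { dist_coef :> fsum X; _ : is_dist dist_coef }.

HB.instance Definition _ (X : Type) := [isSub for @dist_coef X].

Definition expect (X : Type) (p : fsum X) (f : X -> R) : R :=
  \sum_(x <- finsupp p) p x * f x.

Lemma expect_supp (X : Type) (p : fsum X) (f : X -> R) (S : {fset {classic X}}) :
  finsupp p `<=` S -> expect p f = \sum_(x <- S) p x * f x.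
Proof.
move=> pS; apply: big_fset_incl => // x _ xp.
by rewrite fsfun_dflt // mul0r.
Qed.

Lemma dist_ge0 (X : Type) (p : dist X) (x : X) : 0 <= (p : fsum X) x.
Proof.
case: p => p /= /andP[/allP p0 _].
by case: finsuppP => // xp; apply/ltW/p0.
Qed.

Lemma expect1 (X : Type) (p : dist X) : expect p (fun=> 1) = 1.
Proof.
case: p => p /= /andP[_ /eqP p1]; rewrite -[RHS]p1.
by apply: eq_bigr => x _; rewrite mulr1.
Qed.

Lemma is_distP (X : Type) (p : fsum X) :
  (forall x, 0 <= p x) -> expect p (fun=> 1) = 1 -> is_dist p.
Proof.
move=> p0 p1; apply/andP; split.
  by apply/allP => x; rewrite mem_finsupp lt_def p0 andbT.
by rewrite -[X in _ == X]p1; apply/eqP/eq_bigr => x _; rewrite mulr1.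
Qed.

Lemma expect_eq (X : Type) (p : fsum X) (x : X) :
  expect p (fun y => ((y : {classic X}) == x)%:R) = p x.
Proof.
rewrite (@expect_supp _ _ _ ((x : {classic X}) |` finsupp p)) ?fsubsetUr//.
rewrite (big_fsetD1 (x : {classic X})) /=; last by rewrite !inE eqxx.
rewrite eqxx mulr1 big_seq big1 ?addr0// => y.
by rewrite !inE => /andP[/negPf -> _]; rewrite mulr0.
Qed.

Lemma dist_eq (X : Type) (p q : dist X) : expect p =1 expect q -> p = q.
Proof.
move=> pq; apply: val_inj; apply/fsfunP => x /=.
by rewrite -!expect_eq; apply: pq.
Qed.

Lemma eq_expect (X : Type) (p : fsum X) (f g : X -> R) :
  f =1 g -> expect p f = expect p g.
Proof. by move=> fg; apply: eq_bigr => x _; rewrite fg. Qed.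

Definition dunit_coef (X : Type) (x : X) : fsum X :=
  [fsfun y in [fset (x : {classic X})] => 1].

Lemma expect_unit (X : Type) (x : X) f : expect (dunit_coef x) f = f x.
Proof.
rewrite (@expect_supp _ _ _ [fset (x : {classic X})]) ?finsupp_sub//.
by rewrite big_seq_fset1 fsfunE inE eqxx mul1r.
Qed.

Lemma dunit_subproof (X : Type) (x : X) : is_dist (dunit_coef x).
Proof.
apply: is_distP; last by rewrite expect_unit.
by move=> y; rewrite fsfunE; case: ifP.
Qed.

Definition dunit (X : Type) (x : X) : dist X := Dist (dunit_subproof x).

Definition dmap_coef (X Y : Type) (f : X -> Y) (p : fsum X) : fsum Y :=
  [fsfun y in (f : {classic X} -> {classic Y}) @` finsupp p =>
    \sum_(x <- finsupp p | (f x : {classic Y}) == y) p x].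

Lemma expect_map (X Y : Type) (f : X -> Y) (p : fsum X) g :
  expect (dmap_coef f p) g = expect p (g \o f).
Proof.
rewrite (@expect_supp _ _ _ ((f : {classic X} -> {classic Y}) @` finsupp p)) ?finsupp_sub//.
under eq_big_seq => y yS do
  rewrite fsfunE yS big_distrl /= big_mkcond /=.
rewrite exchange_big /=; apply: eq_big_seq => x xp.
rewrite (big_fsetD1 (f x : {classic Y})) /=; last exact: in_imfset.
rewrite eqxx big_seq big1 ?addr0// => y.
by rewrite !inE eq_sym => /andP[/negPf ->].
Qed.

Lemma dmap_subproof (X Y : Type) (f : X -> Y) (p : dist X) :
  is_dist (dmap_coef f p).
Proof.
apply: is_distP; last by rewrite expect_map -[RHS](expect1 p).
move=> y; rewrite fsfunE; case: ifP => // _.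
by apply: sumr_ge0 => x _; apply: dist_ge0.
Qed.

Definition dmap (X Y : Type) (f : X -> Y) (p : dist X) : dist Y :=
  Dist (dmap_subproof f p).

Definition dmult_coef (X : Type) (P : fsum (dist X)) : fsum X :=
  [fsfun x in \bigcup_(p <- finsupp P) finsupp (p : dist X) =>
    \sum_(p <- finsupp P) P p * (p : dist X) x].

Lemma expect_mult (X : Type) (P : fsum (dist X)) f :
  expect (dmult_coef P) f = expect P (fun p => expect p f).
Proof.
pose S := \bigcup_(p <- finsupp P) finsupp (p : dist X).
rewrite (@expect_supp _ _ _ S) ?finsupp_sub//.
under eq_big_seq => x xS do rewrite fsfunE xS big_distrl /=.
rewrite exchange_big /=; apply: eq_big_seq => p pP.
rewrite (@expect_supp _ _ _ S) ?(bigfcup_sup _ pP)// big_distrr /=.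
by apply: eq_bigr => x _; rewrite mulrA.
Qed.

Lemma dmult_subproof (X : Type) (P : dist (dist X)) : is_dist (dmult_coef P).
Proof.
apply: is_distP; last first.
  by rewrite expect_mult -[RHS](expect1 P); apply: eq_expect => p; apply: expect1.
move=> y; rewrite fsfunE; case: ifP => // _.
by apply: sumr_ge0 => p _; apply: mulr_ge0; apply: dist_ge0.
Qed.

Definition dmult (X : Type) (P : dist (dist X)) : dist X :=
  Dist (dmult_subproof P).

Program Definition dist_monad : monad :=
  @Monad dist (@dmap) (@dunit) (@dmult) _ _ _ _ _ _ _.
Next Obligation.
by move=> X p; apply: dist_eq => g; rewrite /= expect_map.
Qed.
Next Obligation.
by move=> X Y Z g f p; apply: dist_eq => h; rewrite /= !expect_map.
Qed.
Next Obligation.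
by move=> X Y f x; apply: dist_eq => g; rewrite /= expect_map !expect_unit.
Qed.
Next Obligation.
move=> X Y f P; apply: dist_eq => g; rewrite /= expect_map !expect_mult.
by rewrite expect_map; apply: eq_expect => p /=; rewrite expect_map.
Qed.
Next Obligation.
move=> X P; apply: dist_eq => g; rewrite /= !expect_mult expect_map.
by apply: eq_expect => p /=; rewrite expect_mult.
Qed.
Next Obligation.
by move=> X p; apply: dist_eq => g; rewrite /= expect_mult expect_unit.
Qed.
Next Obligation.
move=> X p; apply: dist_eq => g; rewrite /= expect_mult expect_map.
by apply: eq_expect => x /=; rewrite expect_unit.
Qed.

(* The subdistribution on [X] identified with a distribution on [option X]:
   the coefficient of [None] is dropped. *)
Definition subdist (X : Type) (p : dist (option X)) : fsum X :=
  [fsfun x in [fset x in (pmap id (finsupp p) : seq {classic X})] => p (Some x)].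

(* [insub q] is [Some q] if [q] is a distribution and [None] otherwise; the
   coefficients of [subdist p] being positive, this only tests whether they
   sum to 1, see [black_holeE]. *)
Definition black_hole (X : Type) (p : dist (option X)) : option (dist X) :=
  insub (subdist p).

Lemma subdistE (X : Type) (p : dist (option X)) (x : X) :
  subdist p x = p (Some x).
Proof.
rewrite fsfunE; case: ifPn => // xN; rewrite fsfun_dflt//.
apply: contra xN => xp; rewrite !inE /=.
have := mem_pmap (id : {classic option X} -> option {classic X}) (finsupp p) x.
by move=> ->; apply/mapP; exists (Some x).
Qed.

Lemma black_holeE (X : Type) (p : dist (option X)) :
  omap val (black_hole p) =
    if \sum_(x <- finsupp (subdist p)) subdist p x == 1
    then Some (subdist p) else None.
Proof.
rewrite /black_hole; case: insubP => [q|].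
  by move=> /andP[_ ->] /= ->.
rewrite /is_dist; case: allP => //= [_ /negPf -> //|[]] x.
by rewrite mem_finsupp lt_def => ->; rewrite subdistE dist_ge0.
Qed.

End Distribution.

(* Main.v *)
Require Import Defs.
From mathcomp Require Import all_boot all_order all_algebra reals.
From mathcomp Require Import finmap boolp ring lra.

(** Write [loss p] for the mass that [p : dist (option X)] puts on [None].

    The black-hole map sends [p] to [Some q] exactly when [p] is the image
    [dmap Some q] of a genuine distribution, and to [None] exactly when
    [loss p != 0] ([black_holeP]).  So each law asks for two things: that losses
    vanish together on both sides, which is a statement about nonnegative
    functions vanishing on the support of a distribution ([expect_eq0]), and that
    the values agree when no mass is lost, which is a monad law of [dist].

    For uniqueness, the law for the unit of [option] forces
    [psi (dmap Some q) = Some q], so it remains to see that [psi p = Some q] is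
    impossible when [p] has mass [t < 1] outside [None].  Collapsing [X] to a
    point [b] of [bool] turns [p] into [t |b> + (1 - t) |None>], which [psi] must
    send to [|b>] by naturality: any lost mass is renormalized.  Now weigh this
    leaky point [b] by [1 / (1 + t)] and the faithful point [~~ b] by
    [t / (1 + t)].  Flattening gives both booleans the mass [t / (1 + t)], so the
    result does not depend on [b]; but compatibility of [psi] with flattening
    computes its value as [1 / (1 + t) |b> + t / (1 + t) |~~ b>].  Comparing the
    two choices of [b] gives [t = 1] ([distributive_law_loss]). *)

Set Implicit Arguments.
Unset Strict Implicit.
Unset Printing Implicit Defensive.

Import Order.TTheory GRing.Theory Num.Theory.
Local Open Scope ring_scope.

(** * Expectations of nonnegative functions *)

Section Expectation.
Variable R : realType.

Lemma expect_ge0 (X : Type) (p : dist R X) (f : X -> R) :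
  (forall x, 0 <= f x) -> 0 <= expect p f.
Proof.
by move=> f0; apply: sumr_ge0 => x _; apply: mulr_ge0 (f0 x); apply: dist_ge0.
Qed.

Lemma expect_eq0 (X : Type) (p : dist R X) (f : X -> R) :
  (forall x, 0 <= f x) ->
  expect p f = 0 <-> (forall x, dist_coef p x != 0 -> f x = 0).
Proof.
move=> f0; split=> [pf0 x px|pf0]; last first.
  rewrite /expect big_seq big1 // => x; rewrite mem_finsupp => /pf0 ->.
  by rewrite mulr0.
have xp : (x : {classic X}) \in finsupp p by rewrite mem_finsupp.
have pf_ge0 y : true -> 0 <= dist_coef p y * f y.
  by move=> _; apply: mulr_ge0 (f0 y); apply: dist_ge0.
have /eqP := pf0; rewrite /expect psumr_eq0; last by move=> y; apply: pf_ge0.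
by move=> /allP/(_ _ xp)/=; rewrite mulf_eq0 (negPf px) => /eqP.
Qed.

Lemma eq_dmap (X Y : Type) (f g : X -> Y) (p : dist R X) :
  (forall x, dist_coef p x != 0 -> f x = g x) -> dmap f p = dmap g p.
Proof.
move=> fg; apply: dist_eq => h; rewrite /= !expect_map.
by apply: eq_big_seq => x; rewrite mem_finsupp /= => /fg ->.
Qed.

Lemma expect_indic_eq0 (X : Type) (p : dist R X) (b : X -> bool) :
  expect p (fun x => (~~ b x)%:R) = 0 <-> (forall x, dist_coef p x != 0 -> b x).
Proof.
rewrite expect_eq0; last by move=> x; apply: ler0n.
by split=> bp x /bp; case: (b x) => //= /eqP; rewrite oner_eq0.
Qed.

Lemma dmap_id (X : Type) (p : dist R X) : dmap id p = p.
Proof. exact: (mmap_id (m := dist_monad R)). Qed.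

Lemma dmap_dunit (X Y : Type) (f : X -> Y) (x : X) :
  dmap f (dunit R x) = dunit R (f x).
Proof. exact: (munit_nat (dist_monad R)). Qed.

Lemma dmap_comp (X Y Z : Type) (g : Y -> Z) (f : X -> Y) (p : dist R X) :
  dmap g (dmap f p) = dmap (g \o f) p.
Proof. exact/esym/(mmap_comp (m := dist_monad R)). Qed.

Lemma dmap_dmult (X Y : Type) (f : X -> Y) (P : dist R (dist R X)) :
  dmap f (dmult P) = dmult (dmap (dmap f) P).
Proof. exact: (mmult_nat (m := dist_monad R)). Qed.

Lemma dmult_dmap_dunit (X : Type) (p : dist R X) :
  dmult (dmap (@dunit R X) p) = p.
Proof. exact: (mmult_unitr (m := dist_monad R)). Qed.

(** * Lost mass and the black-hole map *)

Definition loss (X : Type) (p : dist R (option X)) : R :=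
  expect p (fun o => (~~ isSome o)%:R).

Lemma loss_eq0 (X : Type) (p : dist R (option X)) :
  loss p = 0 <-> (forall o, dist_coef p o != 0 -> isSome o).
Proof. exact: expect_indic_eq0. Qed.

Lemma loss_dmap_eq0 (X Y : Type) (f : X -> option Y) (p : dist R X) :
  loss (dmap f p) = 0 <-> (forall x, dist_coef p x != 0 -> isSome (f x)).
Proof. by rewrite /loss /= expect_map; apply: expect_indic_eq0. Qed.

(** Masses are nonnegative, so a mixture loses nothing only if no component in
    its support does; this is why one leaky component sends the whole mixture
    into the black hole. *)
Lemma loss_dmult_eq0 (X : Type) (P : dist R (dist R (option X))) :
  loss (dmult P) = 0 <-> (forall p, dist_coef P p != 0 -> loss p = 0).
Proof.
rewrite /loss /= expect_mult; apply: expect_eq0 => p.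
by apply: expect_ge0 => o; apply: ler0n.
Qed.

Lemma loss_dunit_None (X : Type) : loss (dunit R (@None X)) = 1.
Proof. by rewrite /loss expect_unit. Qed.

Lemma loss_dmap_Some (X : Type) (q : dist R X) : loss (dmap Some q) = 0.
Proof. exact/loss_dmap_eq0. Qed.

Lemma expect_isSome (X : Type) (p : dist R (option X)) :
  expect p (fun o => (isSome o)%:R) = 1 - loss p.
Proof.
rewrite -[X in X - _](expect1 p) /loss /expect -sumrB; apply: eq_bigr => o _.
by case: (isSome o); rewrite /= ?mulr1 ?mulr0 ?subr0 ?subrr.
Qed.

Lemma loss_le1 (X : Type) (p : dist R (option X)) : loss p <= 1.
Proof.
by rewrite -subr_ge0 -expect_isSome; apply: expect_ge0 => o; apply: ler0n.
Qed.

(** [None] is a single point carrying the rest of the support, so an expectation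
    splits into its term and the expectation over [X]. *)
Lemma expect_subdist (X : Type) (p : dist R (option X)) f :
  expect p f = dist_coef p None * f None + expect (subdist p) (f \o Some).
Proof.
pose some : {classic X} -> {classic option X} := Some.
pose S : {fset {classic option X}} := (some @` finsupp (subdist p))%fset.
have NS : (None : {classic option X}) \notin S by apply/imfsetP => -[x _].
rewrite (@expect_supp _ _ _ _ ((None : {classic option X}) |` S)%fset).
  rewrite big_fsetU1 //= big_imfset /=; last by move=> x y _ _ [].
  by congr (_ + _); apply: eq_bigr => x _; rewrite subdistE.
apply/fsubsetP => -[x|]; rewrite mem_finsupp !inE => px; last by rewrite eqxx.
by apply/orP; right; apply/imfsetP; exists x; rewrite //= mem_finsupp subdistE.
Qed.

Lemma loss_coef (X : Type) (p : dist R (option X)) :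
  loss p = dist_coef p None.
Proof.
rewrite /loss expect_subdist mulr1 /expect big1 ?addr0 // => x _.
by rewrite /= mulr0.
Qed.

(** The case analysis through which every law is proved: the coefficients of
    [subdist p] sum to [1 - loss p], so the test performed by the black-hole map
    is whether the loss vanishes, and then [p] is recovered from the result. *)
Variant black_hole_spec (X : Type) (p : dist R (option X)) :
    option (dist R X) -> Prop :=
  | BlackHoleSome q of p = dmap Some q : black_hole_spec p (Some q)
  | BlackHoleNone of loss p <> 0 : black_hole_spec p None.

Lemma black_holeP (X : Type) (p : dist R (option X)) :
  black_hole_spec p (black_hole p).
Proof.
have mass : expect p (fun=> 1) = loss p + expect (subdist p) (fun=> 1).
  by rewrite expect_subdist mulr1 loss_coef.
rewrite expect1 in mass.
rewrite /black_hole; case: insubP => [q _ /= qE|notdist].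
  have p0 : loss p = 0.
    by move: mass; rewrite -qE (expect1 q) -[LHS]add0r => /addIr.
  constructor; apply: dist_eq => f.
  by rewrite /= expect_map qE expect_subdist -loss_coef p0 mul0r add0r.
constructor=> p0; move: notdist; rewrite is_distP //.
  by move=> x; rewrite subdistE; apply: dist_ge0.
by rewrite [RHS]mass p0 add0r.
Qed.

Lemma dmap_Some_inj (X : Type) : injective (dmap (R := R) (@Some X)).
Proof.
move=> q r qr; apply: dist_eq => f.
have := congr1 (fun p : dist R (option X) => expect p (oapp f 0)) qr.
by rewrite /= !expect_map.
Qed.

Lemma black_hole_Some (X : Type) (q : dist R X) :
  black_hole (dmap Some q) = Some q.
Proof.
by case: black_holeP => [r /dmap_Some_inj <- //|]; rewrite loss_dmap_Some.
Qed.

Lemma black_hole_None (X : Type) (p : dist R (option X)) :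
  loss p <> 0 -> black_hole p = None.
Proof. by case: black_holeP => // q ->; rewrite loss_dmap_Some. Qed.

Lemma isSome_black_hole (X : Type) (p : dist R (option X)) :
  isSome (black_hole p) <-> loss p = 0.
Proof. by case: black_holeP => [q ->|//]; rewrite loss_dmap_Some. Qed.

(** * The black-hole map is a distributive law *)

Lemma black_hole_nat (X Y : Type) (f : X -> Y) (p : dist R (option X)) :
  black_hole (dmap (maybe_map f) p) = maybe_map (dmap f) (black_hole p).
Proof.
case: (black_holeP p) => [q ->|pN] /=.
  have -> : dmap (maybe_map f) (dmap Some q) = dmap Some (dmap f q).
    by rewrite !dmap_comp.
  exact: black_hole_Some.
apply: black_hole_None => /loss_dmap_eq0 fp; apply/pN/loss_eq0 => o /fp.
by case: o.
Qed.

(** In the lossless case no component [p] of [P] is sent to [None], so each can be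
    rebuilt from its image and [P] itself comes from a [Q] of type
    [dist (dist X)]; naturality of flattening then concludes. *)
Lemma black_hole_dmult (X : Type) (P : dist R (dist R (option X))) :
  black_hole (dmult P) =
    maybe_map (@dmult R X) (black_hole (dmap (@black_hole R X) P)).
Proof.
case: (black_holeP (dmap _ P)) => [Q PQ|PN] /=; last first.
  apply: black_hole_None => /loss_dmult_eq0 P0; apply/PN/loss_dmap_eq0 => p.
  by move=> /P0/isSome_black_hole.
(* The value of [g] at [None] is arbitrary, [None] being outside the support. *)
pose g (o : option (dist R X)) := oapp (dmap Some) (dunit R None) o.
have -> : P = dmap (dmap Some) Q.
  have /loss_dmap_eq0 Psome : loss (dmap (@black_hole R X) P) = 0.
    by rewrite PQ loss_dmap_Some.
  have -> : dmap (dmap Some) Q = dmap g (dmap Some Q) by rewrite dmap_comp.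
  rewrite -PQ dmap_comp -[LHS]dmap_id; apply: eq_dmap.
  by move=> p /Psome /=; case: black_holeP.
by rewrite -dmap_dmult black_hole_Some.
Qed.

Lemma black_hole_dunit (X : Type) (o : option X) :
  black_hole (dunit R o) = maybe_map (@dunit R X) o.
Proof.
case: o => [x|] /=; first by rewrite -dmap_dunit black_hole_Some.
by apply: black_hole_None; rewrite loss_dunit_None; apply/eqP/oner_neq0.
Qed.

Lemma black_hole_maybe_mult (X : Type) (p : dist R (option (option X))) :
  black_hole (dmap (@maybe_mult X) p) =
    maybe_mult (maybe_map (@black_hole R X) (black_hole p)).
Proof.
case: (black_holeP p) => [q ->|pN] /=.
  by rewrite dmap_comp dmap_id.
apply: black_hole_None => /loss_dmap_eq0 mp; apply/pN/loss_eq0 => o /mp.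
by case: o.
Qed.

Lemma black_hole_distributive_law :
  is_distributive_law (T := dist_monad R) (S := maybe_monad) (@black_hole R).
Proof.
split=> X /=.
- by move=> Y f p; apply: black_hole_nat.
- exact: black_hole_dmult.
- exact: black_hole_dunit.
- exact: black_hole_maybe_mult.
- exact: black_hole_Some.
Qed.

(** * Uniqueness *)

(** The weights may be [0] or [1]; the support of a finitely supported function is
    computed, so such a coin is still a distribution. *)
Definition coin_coef (w : R) : {fsfun {classic bool} -> R with 0} :=
  [fsfun b in [fset (true : {classic bool}); (false : {classic bool})]%fset =>
    if b then w else 1 - w].

Lemma expect_coin_coef (w : R) (f : bool -> R) :
  expect (coin_coef w) f = w * f true + (1 - w) * f false.
Proof.
pose S := [fset (true : {classic bool}); (false : {classic bool})]%fset.
rewrite (@expect_supp _ _ _ _ S) ?finsupp_sub // /S.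
rewrite big_fsetU1 ?inE /=; last exact/eqP.
by rewrite big_seq_fset1 !fsfunE !inE !eqxx ?orbT.
Qed.

Lemma coin_subproof (w : R) : 0 <= w <= 1 -> is_dist (coin_coef w).
Proof.
move=> /andP[w0 w1]; apply: is_distP; last first.
  by rewrite expect_coin_coef !mulr1 addrC subrK.
by move=> b; rewrite fsfunE; case: ifP => // _; case: b; rewrite ?subr_ge0.
Qed.

Definition coin (w : R) (w01 : 0 <= w <= 1) : dist R bool :=
  Dist (coin_subproof w01).

Lemma expect_maybe_map_cst (X Y : Type) (y : Y) (p : dist R (option X)) f :
  expect (dmap (maybe_map (fun=> y)) p) f =
    (1 - loss p) * f (Some y) + loss p * f None.
Proof.
rewrite /= expect_map -expect_isSome /loss /expect !mulr_suml -big_split /=.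
by apply: eq_bigr => -[x|] _ /=; ring.
Qed.

Section Uniqueness.
Variable psi : forall X,
    dist_monad R (maybe_monad X) -> maybe_monad (dist_monad R X).
Arguments psi {X} _.
Hypothesis psi_dl : is_distributive_law (@psi).

Lemma distributive_law_Some (X : Type) (q : dist R X) :
  psi (dmap Some q) = Some q.
Proof. exact: (distl_unitS psi_dl q). Qed.

(** A distribution that [psi] keeps cannot leak: [mix b] below balances a leaky
    point [b] against a faithful point [~~ b] so that, after flattening, [b] and
    [~~ b] have the same mass, whereas [psi] renormalizes the leaky component
    before it is weighed. *)
Lemma distributive_law_loss (X : Type) (p : dist R (option X)) :
  isSome (psi p) -> loss p = 0.
Proof.
case psip: (psi p) => [q|//] _.
pose leaky (b : bool) := dmap (maybe_map (fun=> b)) p.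
have psi_leaky b : psi (leaky b) = Some (dunit R b).
  have := distl_nat psi_dl (fun=> b) p; rewrite /= psip /= => ->; congr Some.
  apply: dist_eq => f; rewrite /= expect_map expect_unit.
  rewrite -[RHS]mul1r -(expect1 q) /expect mulr_suml.
  by apply: eq_bigr => x _; rewrite mulr1.
(* With [t = 1 - loss p], [w] is the solution [1 / (1 + t)] of [w t = 1 - w]. *)
pose w := (2 - loss p)^-1.
have w_gt0 : 0 < 2 - loss p by have := loss_le1 p; lra.
have w01 : 0 <= w <= 1.
  rewrite invr_ge0 (ltW w_gt0) /=.
  by rewrite invf_le1 //; have := loss_le1 p; lra.
pose mix b :=
  dmap (fun c => if c then leaky b else dunit R (Some (~~ b))) (coin w01).
have psi_mix b :
    psi (dmult (mix b)) = Some (dmap (fun c => if c then b else ~~ b) (coin w01)).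
  have := distl_multT psi_dl (mix b); rewrite /= => ->.
  have -> : dmap psi (mix b) =
      dmap Some (dmap (@dunit R bool)
        (dmap (fun c => if c then b else ~~ b) (coin w01))).
    rewrite /mix !dmap_comp; apply: eq_dmap => -[] _ //=.
    by rewrite -dmap_dunit distributive_law_Some.
  by rewrite distributive_law_Some /= dmult_dmap_dunit.
(* Both sides give mass [w t = 1 - w] to each boolean. *)
have mixC : dmult (mix true) = dmult (mix false).
  apply: dist_eq => f; rewrite /= !expect_mult !expect_map !expect_coin_coef /=.
  rewrite !expect_maybe_map_cst !expect_unit /w; field; exact: lt0r_neq0.
(* Comparing the masses of [true] yields [w = 1 - w], that is, [t = 1]. *)
have := psi_mix true; rewrite mixC psi_mix => /Some_inj mixE.
have := congr1 (fun r : dist R bool => expect r (fun c : bool => c%:R)) mixE.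
rewrite /= !expect_map !expect_coin_coef /= /w => wE.
have : (2 - loss p) * w = 1 by rewrite divff // lt0r_neq0.
by rewrite /w; nra.
Qed.

Lemma distributive_law_eq (X : Type) (p : dist R (option X)) :
  psi p = black_hole p.
Proof.
case: (black_holeP p) => [q ->|pN]; first exact: distributive_law_Some.
case psip: (psi p) => [q|//].
by case: pN; apply: distributive_law_loss; rewrite psip.
Qed.

End Uniqueness.
End Expectation.

Theorem theorem2p11 (R : realType) :
  is_distributive_law (T := dist_monad R) (S := maybe_monad) (@black_hole R) /\
  forall psi : forall X : Type,
      dist_monad R (maybe_monad X) -> maybe_monad (dist_monad R X),
    is_distributive_law psi -> forall X : Type, psi X =1 @black_hole R X.
Proof.
split; first exact: black_hole_distributive_law.
by move=> psi psi_dl X p; apply: distributive_law_eq.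
Qed.
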